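(* Let $w,c,d,\mathit{ch}\ge 0$ be real numbers with $w\ge c$ and $\mathit{ch}>2w$. If $d>c+\mathit{ch}$ and the players $C_1,C_2$ are rational, then Game 1 always terminates at $v_4$; that is, in every sequential equilibrium of Game 1 the terminal node $v_4$ is reached with probability $1$.
   Context: Conventions. Games are finite two-player extensive-form games with imperfect information. A behavior strategy $s_i$ of player $i$ assigns to each information set of $i$ a probability distribution over the actions available there (independently across information sets); it is completely mixed if all actions get positive probability. A belief system $\beta$ assigns to each information set a probability distribution over its nodes. An assessment is a pair $(s,\beta)$ with $s=(s_1,s_2)$ a profile of behavior strategies. Player $i$'s expected payoff at a node $h$ is $u_i(s;h)=\sum_{\zeta}\Pr[\zeta\mid(s,h)]\,u_i(\zeta)$ (sum over terminal nodes $\zeta$), and at an information set $\mathcal I$ of player $i$ it is $u_i(s;\mathcal I,\beta)=\sum_{h\in\mathcal I}\beta(h)u_i(s;h)$. $(s,\beta)$ is sequentially rational if $u_i(s;\mathcal I,\beta)\ge u_i((s_i',s_{-i});\mathcal I,\beta)$ for every player $i$, every information set $\mathcal I$ of $i$ and every behavior strategy $s_i'$ of $i$. It is consistent if there are completely mixed profiles $s^k\to s$ such that the beliefs $\beta^k$ induced by $s^k$ via Bayes' rule converge to $\beta$. A sequential equilibrium is an assessment that is sequentially rational and consistent. Rational players play according to a sequential equilibrium, and ''always terminates at a node'' means that the node is reached with probability $1$. The symbol $\mathit{ch}$ is a single real parameter; the action labels $f(x), r, other$ are formal symbols. Game 1. Players $C_1$ (utility $u_1$) and $C_2$ (utility $u_2$).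 At the root $v_0$, $C_1$ chooses $f(x)$ (to $v_1$), $r$ (to $v_2$) or $other$ (to $v_3$). Then $C_2$ moves, with actions $f(x),r,other$, leading, in this order, from $v_1$ to $v_4,v_5,v_6$; from $v_2$ to $v_7,v_8,v_9$; from $v_3$ to $v_{10},v_{11},v_{12}$ (terminal nodes). Information sets: $\mathcal I_1=\{v_0\}$ for $C_1$ and $\mathcal I_2=\{v_1,v_2,v_3\}$ for $C_2$. With $z=w-c+d-\mathit{ch}$, the payoffs $(u_1,u_2)$ are: $v_4:(w-c,w-c)$; $v_5,v_6:(z,-d)$; $v_7,v_{10}:(-d,z)$; $v_8:(w,w)$; $v_9,v_{11},v_{12}:(-d,-d)$. *)

(* Defs.v *)
From HB Require Import structures.
From mathcomp Require Import all_boot all_order all_algebra.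
From mathcomp Require Import all_classical all_reals all_analysis.
Import Order.TTheory GRing.Theory Num.Theory.
Import numFieldNormedType.Exports.

Set Implicit Arguments.
Unset Strict Implicit.
Unset Printing Implicit Defensive.

Local Open Scope ring_scope.

Inductive player := C1 | C2.

(* Finite two-player extensive-form games with imperfect information and no
   chance moves. Nodes carrying no information set are the terminal ones; the
   actions available at a node depend only on its information set. The last
   three fields say that [next] makes the nodes a tree with root [root].
   Only the values of [payoff] at terminal nodes are ever used. *)
Record game (R : realType) := Game {
  node : finType;
  iset : finType;
  action : finType;
  root : node;
  info : node -> option iset;
  owner : iset -> player;
  avail : iset -> {set action};
  next : node -> action -> option node;
  payoff : player -> node -> R;
  avail_neq0 : forall I, avail I != finset.set0;
  info_surj : forall I, exists h, info h = Some I;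
  next_avail : forall h a,
    isSome (next h a) = (if info h is Some J then a \in avail J else false);
  next_root : forall h a, next h a <> Some root;
  next_inj : forall h h' a a' k,
    next h a = Some k -> next h' a' = Some k -> h = h' /\ a = a';
  root_connect : forall h,
    connect [rel k k' | [exists a, next k a == Some k']] root h
}.

Section Games.
Variables (R : realType) (G : game R).
Implicit Types (i : player) (I : iset G) (h k : node G).

Definition is_dist (T : finType) (A : {set T}) (p : T -> R) : Prop :=
  (forall x, x \in A -> 0 <= p x) /\ \sum_(x in A) p x = 1.

Definition nodes_of I : {set node G} := [set h | info h == Some I].

Definition terminal h : bool := info h == None.

(* A strategy of player [i] is meaningful only at the information sets of [i]
   and at the actions available there; its other values are never used. *)
Definition strategy := iset G -> action G -> R.

Definition behavior_strategy i (si : strategy) : Prop :=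
  forall I, owner I = i -> is_dist (avail I) (si I).

Definition completely_mixed i (si : strategy) : Prop :=
  forall I, owner I = i -> forall a, a \in avail I -> 0 < si I a.

Definition profile := (strategy * strategy)%type.

Definition strat (s : profile) i : strategy :=
  match i with C1 => s.1 | C2 => s.2 end.

(* the profile (si', s_{-i}) *)
Definition deviate (s : profile) i (si' : strategy) : profile :=
  match i with C1 => (si', s.2) | C2 => (s.1, si') end.

Definition behavior_profile (s : profile) : Prop :=
  forall i, behavior_strategy i (strat s i).

Definition completely_mixed_profile (s : profile) : Prop :=
  forall i, completely_mixed i (strat s i).

Fixpoint reach_rec (n : nat) (s : profile) h k : R :=
  if h == k then 1 else
  match n, info h with
  | n'.+1, Some J =>
      \sum_(a in avail J)
        strat s (owner J) J a * oapp (fun h' => reach_rec n' s h' k) 0 (next h a)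
  | _, _ => 0
  end.

(* Pr[k | (s, h)]: a path in the tree has fewer than #|node G| edges, so the
   recursion is never cut short. *)
Definition reach_prob (s : profile) h k : R := reach_rec #|node G| s h k.

Definition node_payoff i (s : profile) h : R :=
  \sum_(z | terminal z) reach_prob s h z * payoff i z.

Definition belief := iset G -> node G -> R.

Definition belief_system (beta : belief) : Prop :=
  forall I, is_dist (nodes_of I) (beta I).

Definition iset_payoff i (s : profile) I (beta : belief) : R :=
  \sum_(h in nodes_of I) beta I h * node_payoff i s h.

Definition sequentially_rational (s : profile) (beta : belief) : Prop :=
  forall i I, owner I = i -> forall si', behavior_strategy i si' ->
    iset_payoff i (deviate s i si') I beta <= iset_payoff i s I beta.

Definition bayes (s : profile) : belief := fun I h =>
  reach_prob s (root G) h / \sum_(k in nodes_of I) reach_prob s (root G) k.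

Definition consistent (s : profile) (beta : belief) : Prop :=
  exists sk : nat -> profile,
    [/\ forall n, behavior_profile (sk n) /\ completely_mixed_profile (sk n),
        forall i I, owner I = i -> forall a, a \in avail I ->
          ((fun n => strat (sk n) i I a) @ \oo --> strat s i I a)%classic
      & forall I h, h \in nodes_of I ->
          ((fun n => bayes (sk n) I h) @ \oo --> beta I h)%classic].

Definition assessment (s : profile) (beta : belief) : Prop :=
  behavior_profile s /\ belief_system beta.

Definition sequential_equilibrium (s : profile) (beta : belief) : Prop :=
  [/\ assessment s beta, sequentially_rational s beta & consistent s beta].

(* Rational players play according to some sequential equilibrium; the game
   terminates at [z] when [z] is reached with probability 1. *)
Definition always_terminates_at (z : node G) : Prop :=
  forall (s : profile) (beta : belief), sequential_equilibrium s beta ->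
    reach_prob s (root G) z = 1.

End Games.

Inductive act1 := a_fx | a_r | a_other.

Inductive iset1 := I_1 | I_2.

Inductive node1 :=
  v0 | v1 | v2 | v3 | v4 | v5 | v6 | v7 | v8 | v9 | v10 | v11 | v12.

Definition act1_seq := [:: a_fx; a_r; a_other].
Definition act1_idx (a : act1) : nat :=
  match a with a_fx => 0 | a_r => 1 | a_other => 2 end.
Lemma act1_idxK : pcancel act1_idx (onth act1_seq). Proof. by case. Qed.
HB.instance Definition _ := Countable.copy act1 (pcan_type act1_idxK).
Lemma act1_enumP : Finite.axiom act1_seq. Proof. by case. Qed.
HB.instance Definition _ := fintype.isFinite.Build act1 act1_enumP.

Definition iset1_seq := [:: I_1; I_2].
Definition iset1_idx (I : iset1) : nat := match I with I_1 => 0 | I_2 => 1 end.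
Lemma iset1_idxK : pcancel iset1_idx (onth iset1_seq). Proof. by case. Qed.
HB.instance Definition _ := Countable.copy iset1 (pcan_type iset1_idxK).
Lemma iset1_enumP : Finite.axiom iset1_seq. Proof. by case. Qed.
HB.instance Definition _ := fintype.isFinite.Build iset1 iset1_enumP.

Definition node1_seq :=
  [:: v0; v1; v2; v3; v4; v5; v6; v7; v8; v9; v10; v11; v12].
Definition node1_idx (v : node1) : nat :=
  match v with
  | v0 => 0 | v1 => 1 | v2 => 2 | v3 => 3 | v4 => 4 | v5 => 5 | v6 => 6
  | v7 => 7 | v8 => 8 | v9 => 9 | v10 => 10 | v11 => 11 | v12 => 12
  end.
Lemma node1_idxK : pcancel node1_idx (onth node1_seq). Proof. by case. Qed.
HB.instance Definition _ := Countable.copy node1 (pcan_type node1_idxK).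
Lemma node1_enumP : Finite.axiom node1_seq. Proof. by case. Qed.
HB.instance Definition _ := fintype.isFinite.Build node1 node1_enumP.

Definition info1 (v : node1) : option iset1 :=
  match v with
  | v0 => Some I_1
  | v1 | v2 | v3 => Some I_2
  | _ => None
  end.

Definition owner1 (I : iset1) : player :=
  match I with I_1 => C1 | I_2 => C2 end.

Definition next1 (v : node1) (a : act1) : option node1 :=
  match v, a with
  | v0, a_fx => Some v1 | v0, a_r => Some v2 | v0, a_other => Some v3
  | v1, a_fx => Some v4 | v1, a_r => Some v5 | v1, a_other => Some v6
  | v2, a_fx => Some v7 | v2, a_r => Some v8 | v2, a_other => Some v9
  | v3, a_fx => Some v10 | v3, a_r => Some v11 | v3, a_other => Some v12
  | _, _ => None
  end.

Definition payoffs1 (R : realType) (w c d ch : R) (v : node1) : R * R :=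
  let z := w - c + d - ch in
  match v with
  | v4 => (w - c, w - c)
  | v5 | v6 => (z, - d)
  | v7 | v10 => (- d, z)
  | v8 => (w, w)
  | v9 | v11 | v12 => (- d, - d)
  | v0 | v1 | v2 | v3 => (0, 0)
  end.

Definition payoff1 (R : realType) (w c d ch : R) (i : player) (v : node1) : R :=
  match i with
  | C1 => (payoffs1 w c d ch v).1
  | C2 => (payoffs1 w c d ch v).2
  end.

Definition avail1 (I : iset1) : {set act1} := [set: act1].

Lemma avail1_neq0 I : avail1 I != finset.set0.
Proof. by apply/set0Pn; exists a_fx; rewrite inE. Qed.

Lemma info1_surj I : exists h, info1 h = Some I.
Proof. by case: I; [exists v0 | exists v1]. Qed.

Lemma next1_avail h a :
  isSome (next1 h a) = (if info1 h is Some J then a \in avail1 J else false).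
Proof. by case: h; case: a => //=; rewrite inE. Qed.

Lemma next1_root h a : next1 h a <> Some v0.
Proof. by case: h; case: a. Qed.

Lemma next1_inj h h' a a' k :
  next1 h a = Some k -> next1 h' a' = Some k -> h = h' /\ a = a'.
Proof. by case: h; case: a => //= -[<-]; case: h'; case: a'. Qed.

Lemma root1_connect h :
  connect [rel k k' | [exists a, next1 k a == Some k']] v0 h.
Proof.
set e := [rel k k' | _].
have step k a k' : next1 k a = Some k' -> connect e v0 k -> connect e v0 k'.
  move=> ek /connect_trans; apply; apply: connect1.
  by apply/existsP; exists a; rewrite ek.
have c0 : connect e v0 v0 := connect0 e v0.
have c1 := step v0 a_fx v1 erefl c0.
have c2 := step v0 a_r v2 erefl c0.
have c3 := step v0 a_other v3 erefl c0.
case: h => //; [ exact: step v1 a_fx _ erefl c1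
  | exact: step v1 a_r _ erefl c1 | exact: step v1 a_other _ erefl c1
  | exact: step v2 a_fx _ erefl c2 | exact: step v2 a_r _ erefl c2
  | exact: step v2 a_other _ erefl c2 | exact: step v3 a_fx _ erefl c3
  | exact: step v3 a_r _ erefl c3 | exact: step v3 a_other _ erefl c3 ].
Qed.

Definition Game1 (R : realType) (w c d ch : R) : game R :=
  @Game R node1 iset1 act1 v0 info1 owner1 avail1 next1 (payoff1 w c d ch)
    avail1_neq0 info1_surj next1_avail next1_root next1_inj root1_connect.

(* Main.v *)
(** Since [d > c + ch], the payoff [w - c + d - ch] exceeds [w], so at
    [I_2] the action [f(x)] strictly dominates the two others whatever the
    belief is: sequential rationality makes [C2] play it with probability 1.
    Against this strategy [f(x)] gives [C1] the payoff [w - c >= 0], while [r]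
    and [other] give [- d < 0], so [C1] plays [f(x)] with probability 1 too. *)
Require Import Defs.
From mathcomp Require Import all_boot all_order all_algebra.
From mathcomp Require Import all_classical all_reals all_analysis.
From mathcomp Require Import lra.
Import Order.TTheory GRing.Theory Num.Theory.
Local Open Scope ring_scope.

Lemma index_enum_act1 : index_enum act1 = act1_seq.
Proof. by rewrite /index_enum 2!unlock. Qed.

Lemma index_enum_node1 : index_enum node1 = node1_seq.
Proof. by rewrite /index_enum 2!unlock. Qed.

Lemma card_node1 : #|{: node1}| = 13.
Proof. by rewrite cardT enumT unlock. Qed.

Lemma sum_avail1 (R : realType) (I : iset1) (F : act1 -> R) :
  \sum_(a in avail1 I) F a = F a_fx + F a_r + F a_other.
Proof.
rewrite (eq_bigl xpredT) => [|a]; last by rewrite inE.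
by rewrite index_enum_act1 !big_cons big_nil addr0 addrA.
Qed.

(** Here [q2] and [q3] are the probabilities of two dominated actions, [D2] and [D3] the gains of
    the first action over them, and the last premise says that switching to the first action does
    not pay. Both of its summands are nonnegative, so each vanishes. *)
Lemma dominant_eq1 (R : realType) (D2 D3 q1 q2 q3 : R) : 0 < D2 -> 0 < D3 ->
  0 <= q2 -> 0 <= q3 -> q1 + q2 + q3 = 1 -> q2 * D2 + q3 * D3 <= 0 ->
  [/\ q1 = 1, q2 = 0 & q3 = 0].
Proof.
move=> D2_gt0 D3_gt0 q2_ge0 q3_ge0 q_sum qD.
have q2D : 0 <= q2 * D2 by rewrite mulr_ge0 // ltW.
have q3D : 0 <= q3 * D3 by rewrite mulr_ge0 // ltW.
have /eqP : q2 * D2 = 0 by lra.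
rewrite mulf_eq0 (gt_eqF D2_gt0) orbF => /eqP q2_eq0.
have /eqP : q3 * D3 = 0 by lra.
rewrite mulf_eq0 (gt_eqF D3_gt0) orbF => /eqP q3_eq0.
by split=> //; lra.
Qed.

Section Payoff.
Variables (R : realType) (G : game R).
Implicit Types (i : player) (s : profile G) (h k : node G).

Lemma reach_rec_terminal n s h k :
  info h = None -> reach_rec n s h k = (h == k)%:R.
Proof. by case: n => [|n] /= => [_|->]; case: eqP. Qed.

Lemma reach_recS n s h k (J : iset G) : info h = Some J -> h != k ->
  reach_rec n.+1 s h k =
  \sum_(a in avail J)
    strat s (owner J) J a * oapp (fun h' => reach_rec n s h' k) 0 (Defs.next h a).
Proof. by move=> /= -> /negbTE ->. Qed.

(** Leaving the fuel [n] free, unlike in [node_payoff], makes backward induction possible: each move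
    uses up one unit. *)
Definition payoff_rec n i s h : R :=
  \sum_(z | terminal z) reach_rec n s h z * payoff i z.

Lemma payoff_rec_terminal n i s h :
  info h = None -> payoff_rec n i s h = payoff i h.
Proof.
move=> hN; rewrite /payoff_rec (bigD1 h) /=; last by rewrite /terminal hN.
rewrite reach_rec_terminal // eqxx mul1r big1 ?addr0 // => z /andP[_ zh].
by rewrite reach_rec_terminal // eq_sym (negbTE zh) mul0r.
Qed.

Lemma payoff_recS n i s h (J : iset G) : info h = Some J ->
  payoff_rec n.+1 i s h =
  \sum_(a in avail J)
    strat s (owner J) J a * oapp (payoff_rec n i s) 0 (Defs.next h a).
Proof.
move=> hJ; rewrite /payoff_rec.
under eq_bigr => z zT.
  rewrite (@reach_recS n s h z J hJ); last first.
    by apply: contraTneq zT => <-; rewrite /terminal hJ.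
  rewrite mulr_suml; over.
rewrite exchange_big; apply: eq_bigr => a _ /=.
case: (Defs.next h a) => [k|] /=.
  by rewrite mulr_sumr; apply: eq_bigr => z _; rewrite mulrA.
by rewrite big1 ?mulr0 // => z _; rewrite mul0r.
Qed.

End Payoff.

Arguments reach_rec : simpl never.
Arguments payoff_rec {R G} n i s h.
Arguments reach_rec_terminal {R G} n s {h} k.
Arguments reach_recS {R G} n s {h k J}.
Arguments payoff_recS {R G} n i s {h J}.

Section Game1.
Variables (R : realType) (w c d ch : R).
Let G := Game1 w c d ch.
Implicit Types (i : player) (s : profile G) (F : node1 -> R).

Lemma sum_nodes_of_I_1 F : \sum_(h in nodes_of (I_1 : iset G)) F h = F v0.
Proof.
rewrite (eq_bigl (fun h => info1 h == Some I_1)) => [|h]; last by rewrite inE.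
by rewrite index_enum_node1 !big_cons big_nil /= addr0.
Qed.

Lemma sum_nodes_of_I_2 F :
  \sum_(h in nodes_of (I_2 : iset G)) F h = F v1 + F v2 + F v3.
Proof.
rewrite (eq_bigl (fun h => info1 h == Some I_2)) => [|h]; last by rewrite inE.
by rewrite index_enum_node1 !big_cons big_nil /= addr0 addrA.
Qed.

(** Every move of [C2] ends the game, so one unit of fuel suffices and the value does not depend on
    [n]. *)
Lemma payoff_rec_I_2 n i s (h : node G) : info h = Some I_2 ->
  payoff_rec n.+1 i s h =
  \sum_(a in avail1 I_2) s.2 I_2 a * oapp (payoff1 w c d ch i) 0 (next1 h a).
Proof.
move=> hI; rewrite (payoff_recS n i s hI); apply: eq_bigr => a _.
by case: h hI => //= _; case: a => /=; rewrite payoff_rec_terminal.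
Qed.

Lemma node_payoff_I_2 i s (h : node G) : info h = Some I_2 ->
  node_payoff i s h =
  \sum_(a in avail1 I_2) s.2 I_2 a * oapp (payoff1 w c d ch i) 0 (next1 h a).
Proof.
rewrite /node_payoff /reach_prob card_node1; exact: (payoff_rec_I_2 12).
Qed.

Lemma node_payoff_v0 i s :
  node_payoff i s (v0 : node G) =
  \sum_(a in avail1 I_1) s.1 I_1 a *
    oapp (fun h : node G => node_payoff i s h) 0 (next1 v0 a).
Proof.
transitivity (payoff_rec 13 i s (v0 : node G)).
  by rewrite /node_payoff /reach_prob card_node1.
rewrite (payoff_recS 12 i s (h := v0 : node G) (J := I_1)) //; apply: eq_bigr => a _.
(* The recursion leaves fuel 12 at the successors, whereas [node_payoff] starts with 13; both values
   agree with the same sum. *)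
by case: a => /=; rewrite node_payoff_I_2 // payoff_rec_I_2.
Qed.

(** Reduces termination at [v4] to both players choosing [f(x)] with probability 1. *)
Lemma reach_prob_v4 s :
  reach_prob s (Defs.root G) (v4 : node G) = s.1 I_1 a_fx * s.2 I_2 a_fx.
Proof.
rewrite /reach_prob card_node1 (reach_recS 12 s (J := I_1)) //.
rewrite sum_avail1 /= !(reach_recS 11 s (J := I_2)) // !sum_avail1 /=.
by rewrite !reach_rec_terminal // eqxx !(mulr0, addr0, mulr1).
Qed.

(** The deviation against which the rationality of both players is tested. *)
Definition pure_fx : strategy G := fun _ a => (a == a_fx :> act1)%:R.

Lemma pure_fx_behavior i : behavior_strategy i pure_fx.
Proof.
move=> I _; split=> [a _|]; first exact: ler0n.
by rewrite sum_avail1 /= !addr0.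
Qed.

End Game1.

Lemma rational_C2_fx (R : realType) (w c d ch : R)
    (s : profile (Game1 w c d ch)) (beta : belief (Game1 w c d ch)) :
  0 <= w -> 0 <= c -> 0 <= ch -> c <= w -> c + ch < d ->
  behavior_profile s -> belief_system beta -> sequentially_rational s beta ->
  [/\ s.2 I_2 a_fx = 1, s.2 I_2 a_r = 0 & s.2 I_2 a_other = 0].
Proof.
move=> w_ge0 c_ge0 ch_ge0 c_le_w d_gt.
move=> /(_ C2 I_2 erefl)[q_ge0 q_sum] /(_ I_2)[b_ge0 b_sum].
move=> /(_ C2 I_2 erefl _ (pure_fx_behavior R w c d ch C2)).
rewrite /iset_payoff !sum_nodes_of_I_2 !node_payoff_I_2 // !sum_avail1 /= => opt.
have /= q2_ge0 := q_ge0 a_r (finset.in_setT _).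
have /= q3_ge0 := q_ge0 a_other (finset.in_setT _).
move: q_sum b_sum; rewrite sum_avail1 sum_nodes_of_I_2 /= => q_sum b_sum.
have b1 : 0 <= beta I_2 v1 by apply: b_ge0; rewrite inE.
have b2 : 0 <= beta I_2 v2 by apply: b_ge0; rewrite inE.
have b3 : 0 <= beta I_2 v3 by apply: b_ge0; rewrite inE.
rewrite /pure_fx eqxx /= in opt.
set q1 := s.2 I_2 a_fx in q_sum opt *.
set q2 := s.2 I_2 a_r in q_sum q2_ge0 opt *.
set q3 := s.2 I_2 a_other in q_sum q3_ge0 opt *.
move: (beta I_2 v1) (beta I_2 v2) (beta I_2 v3) b_sum b1 b2 b3 opt => x1 x2 x3.
move=> x_sum x1_ge0 x2_ge0 x3_ge0 opt.
(* the gains of [f(x)] over [r] and over [other] *)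
pose D2 := x1 * (w - c + d) + x2 * (d - c - ch) + x3 * (w - c + d - ch + d).
pose D3 := x1 * (w - c + d) + (x2 + x3) * (w - c + d - ch + d).
have wd : 0 <= w + d by lra.
(* As the beliefs sum to 1, [D2] is [d - c - ch] plus [x1 * (w + ch) + x3 * (w + d)], and [D3] is
   [d - c - ch] plus [x1 * (w + ch) + (x2 + x3) * (w + d)]. These products are supplied because
   [lra] treats nonlinear monomials as atoms. *)
have x1w : 0 <= x1 * (w + ch) by rewrite mulr_ge0 ?addr_ge0.
have x2w : 0 <= x2 * (w + d) by rewrite mulr_ge0.
have x3w : 0 <= x3 * (w + d) by rewrite mulr_ge0.
have x2E : x2 = 1 - x1 - x3 by lra.
have q1E : q1 = 1 - q2 - q3 by lra.
apply: (@dominant_eq1 R D2 D3) => //.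
- by rewrite /D2 x2E; lra.
- by rewrite /D3; rewrite x2E in x2w *; lra.
(* With [q1] and [x2] eliminated, the gain from deviating to [pure_fx] is exactly
   [q2 * D2 + q3 * D3]. *)
- by rewrite /D2 /D3; rewrite q1E x2E in opt *; lra.
Qed.

Lemma rational_C1_fx (R : realType) (w c d ch : R)
    (s : profile (Game1 w c d ch)) (beta : belief (Game1 w c d ch)) :
  0 <= w -> 0 <= c -> 0 <= ch -> c <= w -> c + ch < d ->
  behavior_profile s -> belief_system beta -> sequentially_rational s beta ->
  s.1 I_1 a_fx = 1.
Proof.
move=> w_ge0 c_ge0 ch_ge0 c_le_w d_gt bs bb rat.
have [e1 e2 e3] : [/\ s.2 I_2 a_fx = 1, s.2 I_2 a_r = 0 & s.2 I_2 a_other = 0].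
  exact: rational_C2_fx bs bb rat.
have [p_ge0 +] := bs C1 I_1 erefl; rewrite sum_avail1 /= => p_sum.
have /= p2_ge0 := p_ge0 a_r (finset.in_setT _).
have /= p3_ge0 := p_ge0 a_other (finset.in_setT _).
have [_] := bb I_1; rewrite sum_nodes_of_I_1 => b_eq1.
have := rat C1 I_1 erefl _ (pure_fx_behavior R w c d ch C1).
rewrite /iset_payoff !sum_nodes_of_I_1 b_eq1 !mul1r !node_payoff_v0.
rewrite !sum_avail1 /= !node_payoff_I_2 // !sum_avail1 /= e1 e2 e3.
rewrite /pure_fx eqxx /= => opt.
(* Against [f(x)], both [r] (at [v7]) and [other] (at [v10]) give [C1] the payoff [- d] instead of
   [w - c], hence the same gain twice. *)
have [] // := @dominant_eq1 R (w - c + d) (w - c + d) _ _ _ _ _ p2_ge0 p3_ge0 p_sum.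
- by lra.
- by lra.
- by nra.
Qed.

Theorem theorem5p2 (R : realType) (w c d ch : R)
    (w_ge0 : 0 <= w) (c_ge0 : 0 <= c) (d_ge0 : 0 <= d) (ch_ge0 : 0 <= ch)
    (c_le_w : c <= w) (ch_gt : 2 * w < ch) (d_gt : c + ch < d) :
  always_terminates_at (v4 : node (Game1 w c d ch)).
Proof.
move=> s beta [[bs bb] rat _]; rewrite reach_prob_v4.
have [-> _ _] : [/\ s.2 I_2 a_fx = 1, s.2 I_2 a_r = 0 & s.2 I_2 a_other = 0].
  exact: rational_C2_fx bs bb rat.
by rewrite mulr1; apply: rational_C1_fx bs bb rat.
Qed.
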